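(* Let $1<p<\infty$ and set $$\alpha_p=\begin{cases}2,&1<p\le 2,\\ p,&2<p<\infty,\end{cases}\qquad C_p=\begin{cases}\dfrac{p-1}{4},&1<p\le 2,\\[4pt] \dfrac{1}{p\,2^{p-1}},&2<p<\infty.\end{cases}$$ Let $(X,\mu)$ be a measure space and let $f,g\in L^p(X,\mu)$ be nonzero real-valued functions. Then $$\|f+g\|_p\le \|f\|_p+\|g\|_p-C_p\,\min\{\|f\|_p,\|g\|_p\}\,\left\|\frac{f}{\|f\|_p}-\frac{g}{\|g\|_p}\right\|_p^{\alpha_p}.$$ Moreover, the constant $C_p$ is best possible in each of the two ranges: for every $p\in(1,\infty)$, there is no constant $C>C_p$ such that the inequality $$\|f+g\|_p\le \|f\|_p+\|g\|_p-C\,\min\{\|f\|_p,\|g\|_p\}\,\left\|\frac{f}{\|f\|_p}-\frac{g}{\|g\|_p}\right\|_p^{\alpha_p}$$ (with the same exponent $\alpha_p$) holds for all measure spaces $(X,\mu)$ and all nonzero real-valued $f,g\in L^p(X,\mu)$.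
   Context: $\|h\|_p=\left(\int_X |h|^p\,d\mu\right)^{1/p}$ denotes the usual $L^p$ norm. ''Nonzero'' means nonzero as an element of $L^p(X,\mu)$, i.e. $\|f\|_p,\|g\|_p>0$. *)

(* Defs.v *)
From HB Require Import structures.
From mathcomp Require Import all_boot all_order all_algebra.
From mathcomp Require Import all_classical all_reals all_analysis.

Set Implicit Arguments.
Unset Strict Implicit.
Unset Printing Implicit Defensive.

Import Order.TTheory GRing.Theory Num.Theory.

Local Open Scope ring_scope.

Definition alpha (R : realType) (p : R) : R := if p <= 2 then 2 else p.

Definition Cp (R : realType) (p : R) : R :=
  if p <= 2 then (p - 1) / 4 else (p * 2 `^ (p - 1))^-1.

(* The real number behind the extended-real [Lnorm]; [fine] sends [+oo] to 0,
   so this is the L^p norm only for [f \in Lfun mu p%:E]. *)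
Definition lpnorm (d : measure_display) (T : measurableType d) (R : realType)
    (mu : {measure set T -> \bar R}) (p : R) (f : T -> R) : R :=
  fine ('N[mu]_p%:E [EFin \o f])%E.

Definition refined_triangle (d : measure_display) (T : measurableType d)
    (R : realType) (mu : {measure set T -> \bar R}) (p C : R) (f g : T -> R) :
    Prop :=
  lpnorm mu p (fun x => f x + g x) <=
    lpnorm mu p f + lpnorm mu p g
    - C * Num.min (lpnorm mu p f) (lpnorm mu p g)
        * (lpnorm mu p (fun x => f x / lpnorm mu p f - g x / lpnorm mu p g))
            `^ (alpha p).

(* Main.v *)
Require Import Defs.
From HB Require Import structures.
From mathcomp Require Import all_boot all_order all_algebra.
From mathcomp Require Import all_classical all_reals all_analysis.
From mathcomp Require Import ring lra.

Import Order.TTheory GRing.Theory Num.Theory.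
Import numFieldNormedType.Exports.

Local Open Scope ring_scope.

(** The inequality is a quantitative form of uniform convexity of L^p.  Assume
    that the norm n of g is at most the norm m of f (the statement is symmetric)
    and put u = f / m and v = g / n.  Then f + g = (m - n) u + n (u + v), so
    Minkowski's inequality reduces everything to the bound
      ||u + v|| <= 2 - C_p ||u - v|| ^ alpha_p
    for unit vectors u and v ([refined_triangle_le]).

    For p > 2 the bound follows from Clarkson's inequality
      |a + b|^p + |a - b|^p <= 2^(p-1) (|a|^p + |b|^p),
    integrated at a = u, b = v, which gives
    ||u + v||^p + ||u - v||^p <= 2^p, and from Bernoulli's inequality for the
    exponent p ([unit_add_le_gt2]).

    For p <= 2 it follows from the Ball-Carlen-Lieb inequality
      ||(u + v) / 2||^2 + (p - 1) ||(u - v) / 2||^2 <= 1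
    and from s <= 1 + s^2 / 4 ([unit_add_le_le2]).  This rests on the two-point
    inequality
      2 (a^2 + (p - 1) b^2)^(p/2) <= |a + b|^p + |a - b|^p  ([two_point]),
    itself a consequence of (1 + x)^p + (1 - x)^p >= 2 + p (p - 1) x^2 on [0, 1]
    and Bernoulli's inequality.  It passes to L^p by a reverse Minkowski
    inequality for the exponent p / 2 <= 1: by Hoelder's inequality for two
    terms, (x + y)^(p/2) dominates, up to the factor (A + B)^(1 - p/2), a linear
    combination of x^(p/2) and y^(p/2), which can be integrated term by term;
    the weights A and B are chosen as the two terms to be bounded.

    Optimality is tested on a space of two atoms of mass 1.  For p > 2 the
    functions (y, delta) and (y, - delta) with y^p + delta^p = 1 and y close to
    1 force C <= C_p ([sharp_gt2]); for p <= 2 the functions (1 + e, 1 - e) and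
    (1 - e, 1 + e) with e close to 0 do so ([sharp_le2]).  In both cases an
    explicit value of the parameter contradicts C > C_p. *)

(** * Bernoulli's inequality and derivatives of powers *)

(** Young's inequality for the product of [t `^ q] and 1. *)
Lemma powR_le_bernoulli (R : realType) (q t : R) : 0 < q <= 1 -> 0 <= t ->
  t `^ q <= 1 + q * (t - 1).
Proof.
move=> /andP[q0]; rewrite le_eqVlt => /predU1P[->|q1] t0.
  by rewrite powRr1//; lra.
have q1' : 0 < (1 - q)^-1 by rewrite invr_gt0; lra.
have := @conjugate_powR R (t `^ q) 1 q^-1 (1 - q)^-1 (powR_ge0 _ _) ler01.
rewrite invr_gt0 !invrK => /(_ q0 q1' (subrKC _ _)).
rewrite mulr1 -powRrM divff ?gt_eqF// powRr1// powR1 => /le_trans; apply.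
lra.
Qed.

(** The previous lemma for the exponent [q^-1] at the point [t `^ q]. *)
Lemma powR_ge_bernoulli (R : realType) (q t : R) : 1 <= q -> 0 <= t ->
  1 + q * (t - 1) <= t `^ q.
Proof.
move=> q1 t0; have q0 : 0 < q by lra.
have := @powR_le_bernoulli R q^-1 (t `^ q).
rewrite invr_gt0 invf_le1// q0 q1 powR_ge0 => /(_ isT isT).
rewrite -powRrM divff ?gt_eqF// powRr1// -lerBlDl ler_pdivlMl//; lra.
Qed.

Lemma powR_sqr (R : realType) (p a : R) : (a ^+ 2) `^ (p / 2) = `|a| `^ p.
Proof.
rewrite -(ger0_norm (sqr_ge0 a)) normrX -powR_mulrn// -powRrM mulrC divfK//.
Qed.

Lemma is_derive_le (R : realType) (f df : R -> R) (a b : R) : a <= b ->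
  (forall x, x \in `[a, b] -> is_derive x 1 f (df x)) ->
  (forall x, x \in `[a, b] -> 0 <= df x) -> f a <= f b.
Proof.
move=> ab fdf df0.
have H1 : forall x, x \in `]a, b[ -> is_derive x 1 f (df x).
  by move=> x xab; apply: fdf; exact: subset_itv_oo_cc.
have H2 : ({within `[a, b], continuous f})%classic.
  by apply: derivable_within_continuous => x /fdf [].
have [c cab fE] := @MVT_segment R f df a b ab H1 H2.
by rewrite -subr_ge0 fE mulr_ge0 ?df0// subr_ge0.
Qed.

Lemma is_derive_powR_shift (R : realType) (p x : R) : 0 < 1 + x ->
  is_derive x 1 (fun y : R => (1 + y) `^ p) (p * (1 + x) `^ (p - 1)).
Proof.
move=> x0.
have H : is_derive x 1 (cst 1 + id : R -> R) (0 + 1) by exact: is_deriveD.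
have H2 := is_derive1_powR p x0.
have := @is_derive1_comp _ (@powR R ^~ p) _ x _ _ H2 H.
by rewrite add0r mulr1.
Qed.

Lemma is_derive_powR_flip (R : realType) (p x : R) : 0 < 1 - x ->
  is_derive x 1 (fun y : R => (1 - y) `^ p) (- (p * (1 - x) `^ (p - 1))).
Proof.
move=> x0.
have H : is_derive x 1 (cst 1 - id : R -> R) (0 - 1) by exact: is_deriveB.
have H2 := is_derive1_powR p x0.
have := @is_derive1_comp _ (@powR R ^~ p) _ x _ _ H2 H.
by rewrite sub0r mulrN1.
Qed.

(** * Second-order bounds on the even part of a power *)

(** The derivative of the difference of the two sides is nonnegative because
    [(1 + y) `^ (r - 1)] and [(1 - y) `^ (r - 1)] have product at least 1, hence
    sum at least 2. *)
Lemma powR_odd_part_ge (R : realType) (r x : R) : 0 < r <= 1 -> 0 <= x < 1 ->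
  2 * r * x <= (1 + x) `^ r - (1 - x) `^ r.
Proof.
move=> /andP[r0 r1] /andP[x0 x1].
pose f : R -> R := fun y => (1 + y) `^ r - (1 - y) `^ r - 2 * r * y.
pose df : R -> R := fun y =>
  r * (1 + y) `^ (r - 1) + r * (1 - y) `^ (r - 1) - 2 * r.
suff : f 0 <= f x by rewrite /f addr0 subr0 powR1; lra.
apply: (@is_derive_le _ f df _ _ x0) => y; rewrite in_itv/= => /andP[y0 yx].
  have D1 : is_derive y 1 _ _ := @is_derive_powR_shift _ r y ltac:(lra).
  have D2 : is_derive y 1 _ _ := @is_derive_powR_flip _ r y ltac:(lra).
  have D3 : is_derive y 1 ((2 * r) \*: (id : R -> R)) ((2 * r) *: 1).
    exact: is_deriveZ.
  have := is_deriveB (is_deriveB D1 D2) D3.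
  by rewrite opprK scaler1.
rewrite /df.
set z := (1 + y) `^ _; set w := (1 - y) `^ _.
have z0 : 0 <= z by exact: powR_ge0.
have w0 : 0 <= w by exact: powR_ge0.
have zw : 1 <= z * w.
  rewrite -powRM; [|lra..].
  have -> : (1 + y) * (1 - y) = 1 - y ^+ 2 by ring.
  rewrite -[leLHS](powRr0 (1 - y ^+ 2)) ger_powR; [by []|nra|lra].
have zw2 : 2 <= z + w.
  rewrite -(@ler_pXn2r _ 2) ?nnegrE ?addr_ge0//.
  by have := sqr_ge0 (z - w); nra.
have : 0 <= r * (z + w - 2) by apply: mulr_ge0; lra.
lra.
Qed.

(** At [x = 1] the base [1 - x] vanishes and the formula for the derivative of a
    power does not apply; [powR_even_part_ge] adds this point. *)
Lemma powR_even_part_ge_lt1 (R : realType) (p x : R) :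
  1 < p <= 2 -> 0 <= x < 1 ->
  2 + p * (p - 1) * x ^+ 2 <= (1 + x) `^ p + (1 - x) `^ p.
Proof.
move=> /andP[p1 p2] /andP[x0 x1].
pose f : R -> R := fun y => (1 + y) `^ p + (1 - y) `^ p - p * (p - 1) * y ^+ 2.
pose df : R -> R := fun y => p * (1 + y) `^ (p - 1) - p * (1 - y) `^ (p - 1)
   - p * (p - 1) * (2 * y).
suff : f 0 <= f x by rewrite /f addr0 subr0 powR1 expr0n/=; lra.
apply: (@is_derive_le _ f df _ _ x0) => y; rewrite in_itv/= => /andP[y0 yx].
  have D1 : is_derive y 1 _ _ := @is_derive_powR_shift _ p y ltac:(lra).
  have D2 : is_derive y 1 _ _ := @is_derive_powR_flip _ p y ltac:(lra).
  have D3 : is_derive y 1 ((p * (p - 1)) \*: (id ^+ 2 : R -> R))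
      ((p * (p - 1)) *: ((2%:R * y ^+ 1) *: 1)).
    exact: is_deriveZ.
  have := is_deriveB (is_deriveD D1 D2) D3.
  by rewrite scaler1 expr1.
have := @powR_odd_part_ge _ (p - 1) y ltac:(lra) ltac:(lra).
rewrite /df; nra.
Qed.

Lemma powR_even_part_ge (R : realType) (p x : R) :
  1 < p <= 2 -> 0 <= x <= 1 ->
  2 + p * (p - 1) * x ^+ 2 <= (1 + x) `^ p + (1 - x) `^ p.
Proof.
move=> p12 /andP[x0]; rewrite le_eqVlt => /predU1P[->|x1]; last first.
  by apply: powR_even_part_ge_lt1; rewrite ?p12 ?x0 ?x1.
move/andP: (p12) => [p1 p2].
have p0 : p != 0 by rewrite gt_eqF//; lra.
rewrite subrr powR0// addr0 expr1n mulr1.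
(* The case [x = 1] is the limit of the previous lemma at [x = 1 - d]. *)
apply/ler_addgt0Pr => e e0.
pose d := Num.min (1 / 2) (e / 5).
have d0 : 0 < d by rewrite lt_min; apply/andP; split; lra.
have d1 : d <= 1 / 2 by rewrite ge_min lexx.
have d2 : d <= e / 5 by rewrite ge_min lexx orbT.
have := @powR_even_part_ge_lt1 R p (1 - d) p12 ltac:(lra).
have k0 : 0 <= p * (p - 1) by apply: mulr_ge0; lra.
have k2 : p * (p - 1) <= 2 by nra.
have A1 : (1 + (1 - d)) `^ p <= (1 + 1) `^ p.
  by rewrite ge0_ler_powR// ?nnegrE; lra.
have B1 : (1 - (1 - d)) `^ p <= 1 - (1 - d) by rewrite ge1r_powR//; lra.
move: k0 k2 A1 B1; set k := p * (p - 1); move=> k0 k2 A1 B1 H.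
have : k * (2 * d) <= 2 * (2 * d) by apply: ler_wpM2r; lra.
have : 0 <= k * d ^+ 2 by rewrite mulr_ge0 ?sqr_ge0.
lra.
Qed.

(** The matching upper bound: with [powR_even_part_ge] it identifies the second
    order term of the left-hand side at 0. *)
Lemma powR_even_part_le (R : realType) (p e : R) :
  1 < p <= 2 -> 0 <= e < 1 ->
  (1 + e) `^ p + (1 - e) `^ p <= 2 + p * (p - 1) * (e ^+ 2 / (1 - e)).
Proof.
move=> /andP[p1 p2] /andP[x0 x1].
pose K := p * (p - 1) / (1 - e).
pose f : R -> R := fun y => K * y ^+ 2 - ((1 + y) `^ p + (1 - y) `^ p).
pose df : R -> R := fun y => K * (2 * y) -
  (p * (1 + y) `^ (p - 1) - p * (1 - y) `^ (p - 1)).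
suff : f 0 <= f e.
  rewrite /f addr0 subr0 powR1 expr0n/= mulr0 /K.
  set a := (_ / _); set b := (e ^+ 2 / _).
  have -> : p * (p - 1) * b = a * e ^+ 2 by rewrite /a /b; ring.
  lra.
apply: (@is_derive_le _ f df _ _ x0) => y; rewrite in_itv/= => /andP[y0 yx].
  have D1 : is_derive y 1 _ _ := @is_derive_powR_shift _ p y ltac:(lra).
  have D2 : is_derive y 1 _ _ := @is_derive_powR_flip _ p y ltac:(lra).
  have D3 : is_derive y 1 (K \*: (id ^+ 2 : R -> R))
      (K *: ((2%:R * y ^+ 1) *: 1)).
    exact: is_deriveZ.
  have := is_deriveB D3 (is_deriveD D1 D2).
  by rewrite scaler1 expr1.
have B1 : (1 + y) `^ (p - 1) <= 1 + (p - 1) * y.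
  by have := @powR_le_bernoulli R (p - 1) (1 + y) ltac:(lra) ltac:(lra);
     rewrite (addrC 1 y) addrK.
have y1 : 0 < 1 - y by lra.
pose s := y / (1 - y).
(* Bernoulli's inequality at [(1 - y)^-1 = 1 + s] bounds [(1 - y) `^ (p - 1)]
   from below. *)
have B2 : 1 - (p - 1) * s <= (1 - y) `^ (p - 1).
  have s0 : 0 <= s by rewrite /s divr_ge0//; lra.
  have B3 := @powR_le_bernoulli R (p - 1) (1 - y)^-1 ltac:(lra) ltac:(rewrite invr_ge0; lra).
  have sE : (1 - y)^-1 - 1 = s by rewrite /s; field; lra.
  rewrite sE -powR_inv1 in B3; last lra.
  rewrite -powRrM mulN1r powRN in B3.
  have P0 : 0 < (1 - y) `^ (p - 1) by rewrite powR_gt0.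
  set P := (1 - y) `^ _ in B3 P0 *.
  have P1 : 1 <= (1 + (p - 1) * s) * P by rewrite -ler_pdivrMr// div1r.
  have u0 : 0 <= (p - 1) * s by rewrite mulr_ge0//; lra.
  nra.
have K0 : 0 <= K by rewrite /K divr_ge0// ?mulr_ge0//; lra.
have sK : p * (p - 1) * s <= K * y.
  have -> : K * y = p * (p - 1) * (y / (1 - e)) by rewrite /K; ring.
  rewrite ler_wpM2l//; first by apply: mulr_ge0; lra.
  by rewrite ler_wpM2l// lef_pV2 ?posrE; lra.
have yK : p * (p - 1) * y <= K * y.
  rewrite ler_wpM2r// /K ler_peMr//; last by rewrite invr_ge1 ?unitfE; lra.
  by rewrite mulr_ge0; lra.
rewrite /df; nra.
Qed.

(** * Pointwise inequalities *)

(** By homogeneity [a] is factored out and [x = b / a] has absolute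
    value at most 1. *)
Lemma two_point_le (R : realType) (p a b : R) : 1 < p <= 2 -> `|b| <= `|a| ->
  2 * (a ^+ 2 + (p - 1) * b ^+ 2) `^ (p / 2) <=
  `|a + b| `^ p + `|a - b| `^ p.
Proof.
move=> p12; move/andP: (p12) => [p1 p2].
have [->|a0] := eqVneq a 0.
  rewrite normr0 normr_le0 => /eqP ->.
  have q0 : p / 2 != 0 by rewrite gt_eqF//; lra.
  have p0 : p != 0 by rewrite gt_eqF//; lra.
  by rewrite addr0 subr0 expr0n/= mulr0 addr0 normr0 !powR0//; lra.
move=> ba; pose x := b / a.
have bE : b = a * x by rewrite /x mulrC divfK.
clearbody x.
have a0' : 0 < `|a| by rewrite normr_gt0.
have x1 : `|x| <= 1.
  by move: ba; rewrite bE normrM -ler_pdivlMl// mulVf ?gt_eqF.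
have -> : a + b = a * (1 + x) by rewrite bE; ring.
have -> : a - b = a * (1 - x) by rewrite bE; ring.
have -> : a ^+ 2 + (p - 1) * b ^+ 2 = a ^+ 2 * (1 + (p - 1) * `|x| ^+ 2).
  by rewrite bE real_normK ?num_real//; ring.
have p10 : 0 <= (p - 1) * `|x| ^+ 2 by rewrite mulr_ge0 ?sqr_ge0//; lra.
rewrite !normrM [X in 2 * X]powRM ?sqr_ge0 ?addr_ge0//.
rewrite !(powRM p (normr_ge0 _) (normr_ge0 _)) powR_sqr -mulrDr mulrCA ler_wpM2l ?powR_ge0//.
apply: (@le_trans _ _ ((1 + `|x|) `^ p + (1 - `|x|) `^ p)).
  apply: le_trans (@powR_even_part_ge R p `|x| p12 _); last by rewrite normr_ge0.
  have := @powR_le_bernoulli R (p / 2) (1 + (p - 1) * `|x| ^+ 2) ltac:(lra) ltac:(lra).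
  lra.
have [x0|x0] := leP 0 x.
  by move: x1; rewrite ger0_norm// => x1; rewrite !ger0_norm; lra.
move: x1; rewrite ltr0_norm// => x1; rewrite opprK addrC !ger0_norm; lra.
Qed.

(** Two-point inequality of Bonami and Gross.  Exchanging [a] and [b] leaves the
    right-hand side unchanged, and increases [a ^+ 2 + (p - 1) * b ^+ 2] when
    [`|a| <= `|b|], since [p - 1 <= 1]. *)
Lemma two_point (R : realType) (p a b : R) : 1 < p <= 2 ->
  2 * (a ^+ 2 + (p - 1) * b ^+ 2) `^ (p / 2) <=
  `|a + b| `^ p + `|a - b| `^ p.
Proof.
move=> p12; move/andP: (p12) => [p1 p2].
have [ba|/ltW ab] := leP `|b| `|a|; first exact: (@two_point_le R).
rewrite addrC (addrC a) (distrC a).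
apply: le_trans (@two_point_le R p b a p12 ab).
have ab2 : a ^+ 2 <= b ^+ 2.
  by rewrite -(real_normK (num_real a)) -(real_normK (num_real b)) lerXn2r ?nnegrE.
rewrite ler_wpM2l// ge0_ler_powR ?nnegrE//.
- lra.
- by rewrite addr_ge0 ?sqr_ge0// mulr_ge0 ?sqr_ge0//; lra.
- by rewrite addr_ge0 ?sqr_ge0// mulr_ge0 ?sqr_ge0//; lra.
nra.
Qed.

(** Hoelder's inequality for two terms, in the form of a lower bound on
    [(x + y) `^ q] that is linear in [x `^ q] and [y `^ q]. *)
Lemma powR_add_hoelder (R : realType) (q x y A B : R) : 0 < q <= 1 ->
  0 <= x -> 0 <= y -> 0 <= A -> 0 <= B ->
  x `^ q * A `^ (1 - q) + y `^ q * B `^ (1 - q) <=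
  (x + y) `^ q * (A + B) `^ (1 - q).
Proof.
move=> /andP[q0]; rewrite le_eqVlt => /predU1P[->|q1] x0 y0 A0 B0.
  by rewrite subrr !powRr0 !mulr1 !powRr1// addr_ge0.
have q1' : 0 < 1 - q by lra.
have := @hoelder2 R (x `^ q) (y `^ q) (A `^ (1 - q)) (B `^ (1 - q)) q^-1 (1 - q)^-1.
rewrite !powR_ge0 !invr_gt0 q0 q1' !invrK => /(_ isT isT isT isT isT isT (subrKC _ _)).
by rewrite -!powRrM !divff ?gt_eqF// !powRr1.
Qed.

(** Superadditivity of the power [q = p / 2 >= 1] bounds the left-hand side by
    [(2 * (a ^+ 2 + b ^+ 2)) `^ q]; midpoint convexity of the same power
    concludes. *)
Lemma clarkson_pointwise (R : realType) (p a b : R) : 2 <= p ->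
  `|a + b| `^ p + `|a - b| `^ p <= 2 `^ (p - 1) * (`|a| `^ p + `|b| `^ p).
Proof.
move=> p2; pose q := p / 2.
have q1 : 1 <= q by rewrite /q; lra.
have q0 : 0 < q by lra.
have pw x : `|x| `^ p = (x ^+ 2) `^ q by rewrite powR_sqr.
have sum_le x y : 0 <= x -> 0 <= y -> x `^ q + y `^ q <= (x + y) `^ q.
  move=> x0 y0; rewrite -(mulr_powRB1 x0 q0) -(mulr_powRB1 y0 q0).
  rewrite -(mulr_powRB1 (addr_ge0 x0 y0) q0) mulrDl.
  by apply: lerD; apply: ler_wpM2l => //; apply: ge0_ler_powR;
    rewrite ?nnegrE ?lerDl ?lerDr//; lra.
have mid x y : 0 <= x -> 0 <= y -> 2 * ((x + y) / 2) `^ q <= x `^ q + y `^ q.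
  move=> x0 y0; have [xy0|xy0] := eqVneq (x + y) 0.
    by rewrite xy0 mul0r powR0 ?gt_eqF// mulr0 addr_ge0 ?powR_ge0.
  set m := (x + y) / 2.
  have m0 : 0 < m by rewrite /m divr_gt0// lt_neqAle eq_sym xy0 addr_ge0.
  have h z : 0 <= z -> m `^ q * (1 + q * (z / m - 1)) <= z `^ q.
    move=> z0; rewrite -{2}(divfK (lt0r_neq0 m0) z) [X in _ <= X]powRM ?(ltW m0)//;
      last by rewrite divr_ge0// ltW.
    by rewrite mulrC ler_wpM2r ?powR_ge0// powR_ge_bernoulli// divr_ge0// ltW.
  apply: le_trans (lerD (h _ x0) (h _ y0)); rewrite -mulrDr.
  have -> : 1 + q * (x / m - 1) + (1 + q * (y / m - 1)) = 2.
    by rewrite /m; field.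
  by rewrite mulrC.
rewrite !pw; apply: le_trans (sum_le _ _ (sqr_ge0 _) (sqr_ge0 _)) _.
have -> : (a + b) ^+ 2 + (a - b) ^+ 2 = 4 * ((a ^+ 2 + b ^+ 2) / 2) by field.
have S0 : 0 <= (a ^+ 2 + b ^+ 2) / 2 by rewrite divr_ge0// addr_ge0 ?sqr_ge0.
rewrite powRM//.
have -> : (4 : R) = 2 ^+ 2 by ring.
rewrite powR_sqr ger0_norm// -(mulr_powRB1 (x := 2) (p := p))//; last lra.
by rewrite (mulrC 2) -mulrA ler_wpM2l ?powR_ge0// mid ?sqr_ge0.
Qed.

(** * The L^p norm *)

Lemma lpnorm_ge0 (d : measure_display) (T : measurableType d) (R : realType)
    (mu : {measure set T -> \bar R}) (p : R) (f : T -> R) : 0 <= lpnorm mu p f.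
Proof. by rewrite fine_ge0 ?Lnorm_ge0. Qed.

Lemma lpnorm_powR (d : measure_display) (T : measurableType d) (R : realType)
    (mu : {measure set T -> \bar R}) (p : R) (f : T -> R) : p != 0 ->
  lpnorm mu p f `^ p = (\int[mu]_x (`|f x| `^ p))%R.
Proof. by move=> p0; rewrite /lpnorm -fine_poweR powR_Lnorm. Qed.

Lemma Lfun_add (d : measure_display) (T : measurableType d) (R : realType)
    (mu : {measure set T -> \bar R}) (p : R) (f g : T -> R) : 1 <= p ->
  f \in Lfun mu p%:E -> g \in Lfun mu p%:E ->
  (fun x => f x + g x) \in Lfun mu p%:E.
Proof.
move=> p1 fL gL; have p1' : (1 <= p%:E)%E by rewrite lee_fin.
have [_ H] := Lfun_addr_closed mu p1'.
exact: (H f g fL gL).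
Qed.

Lemma Lfun_sub (d : measure_display) (T : measurableType d) (R : realType)
    (mu : {measure set T -> \bar R}) (p : R) (f g : T -> R) : 1 <= p ->
  f \in Lfun mu p%:E -> g \in Lfun mu p%:E ->
  (fun x => f x - g x) \in Lfun mu p%:E.
Proof.
move=> p1 fL gL; have p1' : (1 <= p%:E)%E by rewrite lee_fin.
by apply: Lfun_add => //; exact: (Lfun_oppr_closed gL).
Qed.

Lemma Lfun_divr (d : measure_display) (T : measurableType d) (R : realType)
    (mu : {measure set T -> \bar R}) (p c : R) (f : T -> R) : 1 <= p ->
  f \in Lfun mu p%:E -> (fun x => f x / c) \in Lfun mu p%:E.
Proof. by move=> p1 fL; exact: (@Lfun_scale _ _ _ mu f c^-1 p p1 fL). Qed.

Lemma lpnormZ (d : measure_display) (T : measurableType d) (R : realType)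
    (mu : {measure set T -> \bar R}) (p c : R) (f : T -> R) : 1 <= p ->
  f \in Lfun mu p%:E -> lpnorm mu p (fun x => c * f x) = `|c| * lpnorm mu p f.
Proof.
move=> p1 fL; have p1' : (1 <= p%:E)%E by rewrite lee_fin.
have := @LnormZ _ _ _ mu p%:E p1' (@Lfun_Sub _ _ _ mu p%:E p1' f fL) c.
rewrite /lpnorm /= => ->; rewrite fineM//.
have : (f : T -> R) \in Lfun mu p%:E by [].
move=> /andP[_]; rewrite inE/= /finite_norm => fN.
by rewrite ge0_fin_numE ?Lnorm_ge0.
Qed.

Lemma lpnormD (d : measure_display) (T : measurableType d) (R : realType)
    (mu : {measure set T -> \bar R}) (p : R) (f g : T -> R) : 1 <= p ->
  f \in Lfun mu p%:E -> g \in Lfun mu p%:E ->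
  lpnorm mu p (fun x => f x + g x) <= lpnorm mu p f + lpnorm mu p g.
Proof.
move=> p1 fL gL; have p1' : (1 <= p%:E)%E by rewrite lee_fin.
exact: (@ler_LnormD _ _ _ mu p%:E p1' (@Lfun_Sub _ _ _ mu p%:E p1' f fL)
  (@Lfun_Sub _ _ _ mu p%:E p1' g gL)).
Qed.

(** A pointwise linear inequality between p-th powers integrates to the same
    inequality between p-th powers of norms. *)
Lemma lpnorm_powR_le (d : measure_display) (T : measurableType d)
    (R : realType) (mu : {measure set T -> \bar R}) (p c1 c2 c : R)
    (f1 f2 g1 g2 : T -> R) : 1 <= p ->
  f1 \in Lfun mu p%:E -> f2 \in Lfun mu p%:E ->
  g1 \in Lfun mu p%:E -> g2 \in Lfun mu p%:E ->
  (forall x, c1 * `|f1 x| `^ p + c2 * `|f2 x| `^ p <=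
             c * (`|g1 x| `^ p + `|g2 x| `^ p)) ->
  c1 * lpnorm mu p f1 `^ p + c2 * lpnorm mu p f2 `^ p <=
  c * (lpnorm mu p g1 `^ p + lpnorm mu p g2 `^ p).
Proof.
move=> p1 f1L f2L g1L g2L H.
have p0 : p != 0 by rewrite gt_eqF//; lra.
have I (f : T -> R) : f \in Lfun mu p%:E ->
    mu.-integrable setT (EFin \o (fun x => `|f x| `^ p)).
  by move=> fL; exact: Lfun_integrable.
have IZ (k : R) (f : T -> R) : f \in Lfun mu p%:E ->
    mu.-integrable setT (EFin \o (fun x => k * `|f x| `^ p)).
  by move=> /I fI; exact: (integrableZl measurableT k fI).
rewrite !lpnorm_powR// -RintegralD ?I// -!RintegralZl ?I//; last first.
  exact: (integrableD measurableT (I _ g1L) (I _ g2L)).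
rewrite -RintegralD ?IZ//; apply: le_Rintegral => //.
- exact: (integrableD measurableT (IZ _ _ f1L) (IZ _ _ f2L)).
- exact: (integrableZl measurableT c (integrableD measurableT (I _ g1L) (I _ g2L))).
Qed.

Lemma refined_triangleC (d : measure_display) (T : measurableType d)
    (R : realType) (mu : {measure set T -> \bar R}) (p C : R) (f g : T -> R) :
  refined_triangle mu p C f g -> refined_triangle mu p C g f.
Proof.
rewrite /refined_triangle; set m := lpnorm mu p f; set n := lpnorm mu p g.
rewrite (minC n) (addrC n).
have -> : (fun x => g x + f x) = (fun x => f x + g x).
  by apply/funext => x; rewrite addrC.
suff -> : lpnorm mu p (fun x => g x / n - f x / m) =
          lpnorm mu p (fun x => f x / m - g x / n) by [].
rewrite /lpnorm -[in LHS]oppe_Lnorm; congr fine; apply: eq_Lnorm => x /=.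
by rewrite opprB.
Qed.

(** * Uniform convexity and the refined triangle inequality *)

(** Uniform convexity of L^p with modulus of power type p, for [2 < p]. *)
Lemma unit_add_le_gt2 (d : measure_display) (T : measurableType d)
    (R : realType) (mu : {measure set T -> \bar R}) (p : R) (u v : T -> R) :
  2 < p -> u \in Lfun mu p%:E -> v \in Lfun mu p%:E ->
  lpnorm mu p u = 1 -> lpnorm mu p v = 1 ->
  lpnorm mu p (fun x => u x + v x) <=
  2 - (p * 2 `^ (p - 1))^-1 * lpnorm mu p (fun x => u x - v x) `^ p.
Proof.
move=> p2 uL vL u1 v1; have p1 : 1 <= p by lra.
have := @lpnorm_powR_le _ _ _ mu p 1 1 (2 `^ (p - 1)) _ _ _ _ p1
  (@Lfun_add _ _ _ mu p u v p1 uL vL) (@Lfun_sub _ _ _ mu p u v p1 uL vL) uL vL.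
rewrite u1 v1 powR1 !mul1r => H.
have {H} : lpnorm mu p (fun x => u x + v x) `^ p +
    lpnorm mu p (fun x => u x - v x) `^ p <= 2 `^ (p - 1) * (1 + 1).
  by apply: H => x; rewrite !mul1r clarkson_pointwise// ltW.
have := @lpnorm_ge0 _ _ _ mu p (fun x => u x + v x).
set s := lpnorm _ _ _; set t := lpnorm _ _ _ `^ p => s0 H.
have B := @powR_ge_bernoulli R p (s / 2) p1 ltac:(lra).
have k0 : 0 < 2 `^ (p - 1) :> R by rewrite powR_gt0.
have sE : s `^ p = 2 * 2 `^ (p - 1) * (s / 2) `^ p.
  by rewrite mulr_powRB1//; [rewrite -powRM ?divr_ge0// mulrC divfK|lra].
move: H; rewrite {}sE; set k := 2 `^ (p - 1) in k0 * => H.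
have pk0 : 0 < p * k by apply: mulr_gt0; lra.
rewrite lerBrDl -lerBrDr ler_pdivrMl//.
have : 2 * k * (1 + p * (s / 2 - 1)) <= 2 * k * (s / 2) `^ p.
  by rewrite ler_wpM2l// mulr_ge0// ltW.
lra.
Qed.

(** Uniform convexity of L^p with modulus of power type 2, for [p <= 2]. *)
Lemma unit_add_le_le2 (d : measure_display) (T : measurableType d)
    (R : realType) (mu : {measure set T -> \bar R}) (p : R) (u v : T -> R) :
  1 < p <= 2 -> u \in Lfun mu p%:E -> v \in Lfun mu p%:E ->
  lpnorm mu p u = 1 -> lpnorm mu p v = 1 ->
  lpnorm mu p (fun x => u x + v x) <=
  2 - (p - 1) / 4 * lpnorm mu p (fun x => u x - v x) ^+ 2.
Proof.
move=> p12 uL vL u1 v1; move/andP: (p12) => [p1 p2].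
have p1' := ltW p1.
set s := lpnorm mu p (fun x => u x + v x).
set t := lpnorm mu p (fun x => u x - v x).
pose q := p / 2; pose A := (s / 2) ^+ 2; pose B := (p - 1) * (t / 2) ^+ 2.
have p10 : 0 <= p - 1 by lra.
have A0 : 0 <= A by rewrite sqr_ge0.
have B0 : 0 <= B by rewrite mulr_ge0 ?sqr_ge0.
have q01 : 0 < q <= 1 by rewrite /q; lra.
have s0 : 0 <= s by exact: lpnorm_ge0.
have t0 : 0 <= t by exact: lpnorm_ge0.
have half (z : R) : ((z / 2) ^+ 2) `^ q = (2 `^ p)^-1 * `|z| `^ p.
  rewrite powR_sqr normrM (powRM _ (normr_ge0 _) (normr_ge0 _)) mulrC.
  by rewrite [`|2^-1|]ger0_norm// -(powR_inv1 (ler0n R 2)) -powRrM mulN1r powRN.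
have sE : A `^ q = (2 `^ p)^-1 * s `^ p by rewrite half ger0_norm.
have tE : B `^ q = (p - 1) `^ q * ((2 `^ p)^-1 * t `^ p).
  by rewrite powRM ?sqr_ge0// half ger0_norm.
(* The two-point inequality at [a = (u + v) / 2] and [b = (u - v) / 2], made
   linear by Hoelder's inequality with weights [A] and [B], is integrated. *)
have H : A `^ q * A `^ (1 - q) + B `^ q * B `^ (1 - q) <= (A + B) `^ (1 - q).
  have L := @lpnorm_powR_le _ _ _ mu p (A `^ (1 - q) * (2 `^ p)^-1)
    ((p - 1) `^ q * B `^ (1 - q) * (2 `^ p)^-1) ((A + B) `^ (1 - q) / 2)
    _ _ _ _ p1'
    (@Lfun_add _ _ _ mu p u v p1' uL vL) (@Lfun_sub _ _ _ mu p u v p1' uL vL)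
    uL vL.
  rewrite u1 v1 powR1 -/s -/t in L.
  suff {}/L : forall x, A `^ (1 - q) * (2 `^ p)^-1 * `|u x + v x| `^ p +
      (p - 1) `^ q * B `^ (1 - q) * (2 `^ p)^-1 * `|u x - v x| `^ p <=
      (A + B) `^ (1 - q) / 2 * (`|u x| `^ p + `|v x| `^ p).
    by rewrite sE tE; lra.
  move=> x.
  pose a := (u x + v x) / 2; pose b := (u x - v x) / 2.
  have h := @powR_add_hoelder R q (a ^+ 2) ((p - 1) * b ^+ 2) A B q01
    (sqr_ge0 _) (mulr_ge0 p10 (sqr_ge0 _)) A0 B0.
  have tp := @two_point R p a b p12.
  have ab1 : a + b = u x by rewrite /a /b; field.
  have ab2 : a - b = v x by rewrite /a /b; field.
  rewrite ab1 ab2 -/q in tp.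
  rewrite powRM ?sqr_ge0// !half in h.
  have {}tp := ler_wpM2l (powR_ge0 (A + B) (1 - q)) tp.
  lra.
have AE (z : R) : 0 <= z -> z `^ q * z `^ (1 - q) = z.
  by move=> z0; rewrite -powRD subrKC ?powRr1//  oner_eq0.
rewrite !AE// in H.
have S1 : A + B <= 1.
  have [S0|S0] := leP (A + B) 0; first by lra.
  rewrite -[X in X <= _](AE _ (ltW S0)) ger_pMl ?powR_gt0// in H.
  rewrite leNgt; apply/negP => S1; move: H; apply/negP; rewrite -ltNge.
  have q0 : 0 < q by case/andP: q01.
  have := @gt0_ltr_powR R q q0 1 (A + B).
  by rewrite !nnegrE powR1; apply => //; exact: ltW.
(* [s <= 1 + (s / 2) ^+ 2 = 1 + A <= 2 - B] *)
have : 0 <= (s / 2 - 1) ^+ 2 by exact: sqr_ge0.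
move: S1; rewrite /A /B; nra.
Qed.

(** The refined triangle inequality when [f] has the larger norm. *)
Lemma refined_triangle_le (d : measure_display) (T : measurableType d)
    (R : realType) (mu : {measure set T -> \bar R}) (p : R) (f g : T -> R) :
  1 < p -> f \in Lfun mu p%:E -> g \in Lfun mu p%:E ->
  0 < lpnorm mu p f -> 0 < lpnorm mu p g -> lpnorm mu p g <= lpnorm mu p f ->
  refined_triangle mu p (Cp p) f g.
Proof.
move=> p1 fL gL; have p1' := ltW p1.
rewrite /refined_triangle; set m := lpnorm mu p f; set n := lpnorm mu p g.
move=> m0 n0 nm.
pose u x := f x / m; pose v x := g x / n.
have uL : u \in Lfun mu p%:E by exact: Lfun_divr.
have vL : v \in Lfun mu p%:E by exact: Lfun_divr.
have u1 : lpnorm mu p u = 1.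
  rewrite (_ : u = fun x => m^-1 * f x); last by apply/funext => x; rewrite mulrC.
  by rewrite lpnormZ// ger0_norm ?invr_ge0 ?ltW// mulVf ?gt_eqF.
have v1 : lpnorm mu p v = 1.
  rewrite (_ : v = fun x => n^-1 * g x); last by apply/funext => x; rewrite mulrC.
  by rewrite lpnormZ// ger0_norm ?invr_ge0 ?ltW// mulVf ?gt_eqF.
have uvL : (fun x => u x + v x) \in Lfun mu p%:E by exact: Lfun_add.
have key : lpnorm mu p (fun x => u x + v x) <=
    2 - Cp p * lpnorm mu p (fun x => u x - v x) `^ alpha p.
  rewrite /Cp /alpha; case: ifPn => [p2|]; last first.
    by rewrite -ltNge => p2; exact: unit_add_le_gt2.
  by rewrite powR_mulrn ?lpnorm_ge0//; apply: unit_add_le_le2; rewrite ?p1.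
have ZL c (h : T -> R) : h \in Lfun mu p%:E ->
    (fun x => c * h x) \in Lfun mu p%:E.
  by move=> hL; have := @Lfun_divr _ _ _ mu p c^-1 h p1' hL;
    under eq_fun do rewrite invrK mulrC.
have -> : (fun x => f x + g x) = (fun x => (m - n) * u x + n * (u x + v x)).
  by apply/funext => x; rewrite /u /v; field; rewrite !gt_eqF.
apply: le_trans (@lpnormD _ _ _ mu p _ _ p1' (ZL _ _ uL) (ZL _ _ uvL)) _.
rewrite !lpnormZ// u1 mulr1 !ger0_norm ?subr_ge0 ?(ltW n0)//.
rewrite min_r//.
have := ler_wpM2l (ltW n0) key; rewrite -/u -/v /=.
by lra.
Qed.

(** * Optimality of the constant *)

(** The counting measure on a space of two atoms, as a sum of two Dirac
    masses. *)
Definition two_points (R : realType) : {measure set bool -> \bar R} :=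
  measure_add \d_true \d_false.

Lemma integral_two_points (R : realType) (h : bool -> R) :
  (forall x, 0 <= h x) ->
  (\int[two_points R]_x (h x)%:E)%E = (h true + h false)%:E.
Proof.
move=> h0; rewrite ge0_integral_measure_add//; last first.
  by move=> x _; rewrite lee_fin.
by rewrite !integral_dirac// !diracT !mul1e.
Qed.

Lemma lpnorm_two_points (R : realType) (p : R) (f : bool -> R) :
  lpnorm (two_points R) p f = (`|f true| `^ p + `|f false| `^ p) `^ p^-1.
Proof.
rewrite /lpnorm unlock/= -[RHS]/(fine (_ `^ p^-1)%:E) -poweR_EFin.
by rewrite -(integral_two_points R (fun x => `|f x| `^ p))// => x;
  exact: powR_ge0.
Qed.

Lemma Lfun_two_points (R : realType) (p : R) (f : bool -> R) :
  f \in Lfun (two_points R) p%:E.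
Proof.
rewrite inE; apply/andP; split; first by rewrite inE.
rewrite inE/= /finite_norm unlock/=.
have := integral_two_points R (fun x => `|f x| `^ p) (fun x => powR_ge0 _ _).
by move=> ->; rewrite poweR_EFin ltry.
Qed.

(** With [y `^ p + delta `^ p = 1], the inequality for [(y, delta)] and
    [(y, - delta)] reads [c * (1 - y `^ p) <= 1 - y] for [c = C * 2 `^ (p - 1)],
    which fails near [y = 1] as soon as [1 < c * p]. *)
Lemma sharp_gt2 (R : realType) (p C : R) : 2 < p -> (p * 2 `^ (p - 1))^-1 < C ->
  exists f g : bool -> R, [/\ 0 < lpnorm (two_points R) p f,
    0 < lpnorm (two_points R) p g & ~ refined_triangle (two_points R) p C f g].
Proof.
move=> p2 CC; have p0 : 0 < p by lra.
have k0 : 0 < 2 `^ (p - 1) :> R by rewrite powR_gt0.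
pose c := C * 2 `^ (p - 1).
have cp : 1 < c * p.
  move: CC; rewrite -div1r ltr_pdivrMr ?mulr_gt0// /c => H.
  by apply: (lt_le_trans H); rewrite le_eqVlt; apply/orP; left; apply/eqP; ring.
have D0 : 0 < p - 1 + c * p by lra.
(* [eta = 1 - y] is small enough for [(p - 1) * eta < c * p - 1]. *)
pose eta := (c * p - 1) / (p - 1 + c * p).
have eta0 : 0 < eta by apply: divr_gt0; lra.
have eta1 : eta < 1 by rewrite /eta ltr_pdivrMr//; lra.
have etap : (p - 1) * eta < c * p - 1.
  rewrite /eta mulrCA gtr_pMr; last lra.
  by rewrite ltr_pdivrMr//; lra.
have [y yE] : exists y, y = 1 - eta by exists (1 - eta).
have y0 : 0 < y by lra.
have yp : y `^ p <= y by rewrite ge1r_powR//; lra.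
have dp : 0 <= 1 - y `^ p by lra.
pose delta := (1 - y `^ p) `^ p^-1.
have deltap : delta `^ p = 1 - y `^ p.
  by rewrite /delta -powRrM mulVf ?gt_eqF// powRr1.
have delta0 : 0 <= delta by exact: powR_ge0.
clearbody delta eta.
pose f (b : bool) := if b then y else delta.
pose g (b : bool) := if b then y else - delta.
have f1 : lpnorm (two_points R) p f = 1.
  by rewrite lpnorm_two_points/= !ger0_norm ?(ltW y0)// deltap subrKC powR1.
have g1 : lpnorm (two_points R) p g = 1.
  by rewrite lpnorm_two_points/= normrN !ger0_norm ?(ltW y0)//
    deltap subrKC powR1.
exists f, g; rewrite f1 g1 ltr01; split=> //.
rewrite /refined_triangle f1 g1 !lpnorm_two_points/= subrr subrr normr0.
rewrite /alpha ifF; last by apply/negbTE; rewrite -ltNge.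
rewrite powR0 ?gt_eqF// addr0 add0r -!powRrM mulVf ?gt_eqF// mulfV ?gt_eqF//.
rewrite mulr1 !powRr1//.
rewrite !divr1 minxx mulr1 opprK.
rewrite ger0_norm ?addr_ge0 ?(ltW y0)//.
have -> : delta + delta = 2 * delta by ring.
rewrite normrM (ger0_norm delta0) ger0_norm// powRM// deltap.
rewrite -(mulr_powRB1 (x := 2) (p := p))//.
(* Bernoulli's inequality at [y^-1] bounds [1 - y `^ p] from below. *)
have B := @powR_ge_bernoulli R p y^-1 ltac:(lra) ltac:(rewrite invr_ge0 ltW//).
have P0 : 0 < y `^ p by rewrite powR_gt0.
have := ler_wpM2r (ltW P0) B.
rewrite -[X in _ <= X -> _]powRM ?invr_ge0 ?(ltW y0)// mulVf ?gt_eqF// powR1.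
move=> B2.
have B3 : y `^ p * (y + p * (1 - y)) <= y.
  have := ler_wpM2r (ltW y0) B2; rewrite mul1r; apply: le_trans.
  rewrite le_eqVlt; apply/orP; left; apply/eqP; field; lra.
have B4 : p * eta <= (1 - y `^ p) * (1 + (p - 1) * eta).
  by rewrite yE in B3 *; lra.
rewrite -/c; move=> H.
have H2 : c * (1 - y `^ p) <= eta by rewrite yE in H *; rewrite /c; lra.
have c0 : 0 < c by rewrite -(pmulr_lgt0 _ p0); lra.
have := ler_wpM2l (ltW c0) B4.
have := ler_wpM2r (_ : 0 <= 1 + (p - 1) * eta) H2.
have e1 : 0 < (p - 1) * eta by apply: mulr_gt0; lra.
move=> /(_ ltac:(lra)) H3 H4.
have H5 : c * p * eta <= (1 + (p - 1) * eta) * eta by lra.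
by move: H5; rewrite ler_pM2r//; lra.
Qed.

(** With [N `^ p = ((1 + e) `^ p + (1 - e) `^ p) / 2], the inequality for
    [(1 + e, 1 - e)] and [(1 - e, 1 + e)] reads [2 * C * e ^+ 2 <= N * (N - 1)],
    whereas [N - 1] is at most [(p - 1) / 2 * (e ^+ 2 / (1 - e))]. *)
Lemma sharp_le2 (R : realType) (p C : R) : 1 < p <= 2 -> (p - 1) / 4 < C ->
  exists f g : bool -> R, [/\ 0 < lpnorm (two_points R) p f,
    0 < lpnorm (two_points R) p g & ~ refined_triangle (two_points R) p C f g].
Proof.
move=> /andP[p1 p2] CC; have p0 : 0 < p by lra.
have D0 : 0 < 2 * (4 * C + p - 1) by lra.
(* [e] is small enough for [(1 + e) * (p - 1) < 4 * C * (1 - e)]. *)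
pose e := (4 * C - (p - 1)) / (2 * (4 * C + p - 1)).
have e0 : 0 < e by apply: divr_gt0; lra.
have e12 : e < 1 / 2 by rewrite /e ltr_pdivrMr//; lra.
have eC : e * (4 * C + p - 1) < 4 * C - (p - 1).
  by rewrite -(ltr_pM2r (ltr0Sn R 1)) mulrAC -mulrA /e divfK ?gt_eqF//; lra.
clearbody e.
pose f (b : bool) := if b then 1 + e else 1 - e.
pose g (b : bool) := if b then 1 - e else 1 + e.
pose h := (1 + e) `^ p + (1 - e) `^ p.
have h0 : 0 < h by rewrite addr_gt0 ?powR_gt0//; lra.
pose k : R := 2 `^ p^-1; have k0 : 0 < k by rewrite powR_gt0.
pose n := h `^ p^-1; have n0 : 0 < n by rewrite powR_gt0.
have f1 : lpnorm (two_points R) p f = n.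
  by rewrite lpnorm_two_points/= !ger0_norm//; lra.
have g1 : lpnorm (two_points R) p g = n.
  by rewrite lpnorm_two_points/= addrC !ger0_norm//; lra.
have cst2 (x : R) : 0 <= x -> (x `^ p + x `^ p) `^ p^-1 = x * k.
  move=> x0; have -> : x `^ p + x `^ p = x `^ p * 2 by ring.
  by rewrite powRM ?powR_ge0// -powRrM mulfV ?gt_eqF// powRr1.
exists f, g; rewrite f1 g1 n0; split=> //.
rewrite /refined_triangle f1 g1 !lpnorm_two_points/= minxx /alpha p2.
have -> : 1 + e + (1 - e) = 2 by ring.
have -> : 1 - e + (1 + e) = 2 by ring.
have -> : (1 + e) / n - (1 - e) / n = 2 * e / n by ring.
have -> : (1 - e) / n - (1 + e) / n = - (2 * e / n) by ring.
have en0 : 0 <= 2 * e / n.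
  by apply: divr_ge0; [apply: mulr_ge0 => //|]; exact: ltW.
rewrite normrN !(ger0_norm en0) ger0_norm// !cst2// powR_mulrn; last first.
  by rewrite mulr_ge0// ltW.
pose N := n / k; have N0 : 0 < N by rewrite divr_gt0.
have nE : n = N * k by rewrite /N divfK ?gt_eqF.
have -> : 2 * e / n * k = 2 * e / N by rewrite nE; field; rewrite !gt_eqF.
rewrite nE => H.
have H1 : 2 * C * e ^+ 2 <= N * (N - 1).
  have : 0 <= N / (2 * k) *
      (N * k + N * k - C * (N * k) * (2 * e / N) ^+ 2 - 2 * k).
    apply: mulr_ge0; last by rewrite subr_ge0.
    by apply: divr_ge0; [|apply: mulr_ge0 => //]; exact: ltW.
  rewrite (_ : _ * _ = N * (N - 1) - 2 * C * e ^+ 2) ?subr_ge0//.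
  by field; rewrite !gt_eqF.
have NP : N `^ p = h / 2.
  rewrite /N powRM ?invr_ge0 ?ltW// /n -powRrM mulVf ?gt_eqF// powRr1 ?(ltW h0)//.
  by rewrite -powR_inv1 ?(ltW k0)// -powRrM mulN1r powRN /k -powRrM mulVf ?gt_eqF//
    powRr1.
have e1 : 0 < 1 - e by lra.
pose w := e ^+ 2 / (1 - e).
have w0 : 0 <= w by apply: divr_ge0; [exact: sqr_ge0|exact: ltW].
have we : w <= e by rewrite /w ler_pdivrMr// expr2 ler_wpM2l ?ltW//; lra.
have NB : p * (N - 1) <= p * ((p - 1) / 2 * w).
  have := @powR_ge_bernoulli R p N (ltW p1) (ltW N0).
  have := @powR_even_part_le R p e ltac:(lra) ltac:(lra).
  rewrite NP -/h -/w; lra.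
rewrite ler_pM2l// in NB.
have pw : (p - 1) / 2 * w <= w by rewrite ler_piMl//; lra.
have NN : N * (N - 1) <= (1 + e) * ((p - 1) / 2 * w).
  have z0 : 0 <= (p - 1) / 2 * w by rewrite mulr_ge0//; lra.
  have [N1|N1] := leP 1 N; first by apply: ler_pM; lra.
  apply: (@le_trans _ _ 0); first by rewrite mulr_ge0_le0//; lra.
  by apply: mulr_ge0 => //; lra.
have H2 := ler_wpM2r (ltW e1) (le_trans H1 NN).
have wE : w * (1 - e) = e ^+ 2 by rewrite /w divfK ?gt_eqF.
have H3 : e ^+ 2 * (4 * C * (1 - e)) <= e ^+ 2 * ((1 + e) * (p - 1)).
  rewrite -wE in H2 *; lra.
rewrite ler_pM2l ?exprn_gt0// in H3.
lra.
Qed.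

Theorem theorem1 (R : realType) (p : R) (hp : 1 < p) :
  (forall (d : measure_display) (T : measurableType d)
      (mu : {measure set T -> \bar R}) (f g : T -> R),
    f \in Lfun mu p%:E -> g \in Lfun mu p%:E ->
    0 < lpnorm mu p f -> 0 < lpnorm mu p g ->
    refined_triangle mu p (Cp p) f g)
  /\
  (forall C : R, Cp p < C ->
    ~ (forall (d : measure_display) (T : measurableType d)
          (mu : {measure set T -> \bar R}) (f g : T -> R),
        f \in Lfun mu p%:E -> g \in Lfun mu p%:E ->
        0 < lpnorm mu p f -> 0 < lpnorm mu p g ->
        refined_triangle mu p C f g)).
Proof.
split=> [d T mu f g fL gL f0 g0|C CC H].
  have [fg|/ltW gf] := leP (lpnorm mu p g) (lpnorm mu p f).
    exact: refined_triangle_le.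
  by apply: refined_triangleC; exact: refined_triangle_le.
suff [f [g [f0 g0]]] : exists f g : bool -> R,
    [/\ 0 < lpnorm (two_points R) p f, 0 < lpnorm (two_points R) p g &
        ~ refined_triangle (two_points R) p C f g].
  by apply; apply: H => //; exact: Lfun_two_points.
move: CC; rewrite /Cp; case: ifPn => [p2|]; first by apply: sharp_le2; rewrite hp.
by rewrite -ltNge; exact: sharp_gt2.
Qed.
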